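(* Suppose $V$ and $T$ are semigroups such that $T$ has a left action on $V^1$ by semigroup morphisms. Suppose also that $\sigma$ is a special congruence on the semidirect product $V\rtimes T$. Then there is an action pair $(U,S)$ in some monoid $M$ such that $$U\cong V,\qquad S\cong T\qquad\text{and}\qquad US\cong (V\rtimes T)/\sigma .$$ If $T$ acts on $V^1$ by monoid morphisms, then $(U,S)$ is strong. Conversely, given any action pair $(U,S)$, we have $US\cong (U\rtimes S)/\theta$ for some special congruence $\theta$ on the semidirect product $U\rtimes S$.
   Context: Conventions. For a semigroup $V$, $V^1$ is the monoid completion: $V^1=V$ if $V$ is a monoid, otherwise $V^1=V\sqcup\{1\}$ with $1$ an adjoined identity. If $U$ is given as a subsemigroup of a specified monoid $M$ with identity $1$, then $U^1$ denotes $U\cup\{1\}\leq M$. Actions. A left action of a semigroup $S$ on a set $X$ is a map $(s,x)\mapsto {}^sx$ with ${}^s({}^tx)={}^{st}x$. It is by semigroup morphisms on a semigroup $X$ if ${}^s(xy)={}^sx\cdot{}^sy$ for all $s,x,y$; it is by monoid morphisms on a monoid $X$ if moreover ${}^s1=1$ for all $s$. (If $S$ is a monoid, its identity is not required to act identically.) Semidirect product. If $S$ acts on $U^1$ on the left by semigroup morphisms, $U\rtimes S=\{(u,s):u\in U,\ s\in S\}$ with product $(u,s)(v,t)=(u\cdot{}^sv,st)$. Action pairs. A (left) action pair in a monoid $M$ (with identity $1$) is a pair $(U,S)$ of subsemigroups of $M$ together with a left action of $S$ on $U^1=U\cup\{1\}$ by semigroup morphisms such that: (A1) $s\cdot u={}^su\cdot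 s$ for all $s\in S$, $u\in U^1$; (A2) $us=vt\Rightarrow u\cdot{}^s1=v\cdot{}^t1$ for all $u,v\in U^1$ and $s,t\in S$. Then $US=\{us:u\in U,\ s\in S\}$ is a subsemigroup of $M$. The pair is strong if (SA1) $sU^1\subseteq U^1s$ for all $s\in S$, and (SA2) $us=vt\Rightarrow u=v$ for all $u,v\in U^1$, $s,t\in S$. Special congruences. Let $T$ have a left action on $V^1$ by semigroup morphisms, and write $s^+={}^s1\in V^1$ for $s\in T$. Let $\sigma$ be a congruence on $V\rtimes T$, and for $u\in V$ put $\sigma_u=\{(s,t)\in T\times T:(u,s)\mathrel{\sigma}(u,t)\}$. If $V$ is not a monoid (so $1\notin V$), additionally define $\sigma_1=\Delta_T=\{(s,s):s\in T\}$. Then $\sigma$ is special if all the following hold (a statement $(u,s)\mathrel\sigma(v,t)$ presupposes $u,v\in V$): (S1) for all $u\in V$, $s\in T$: $(u,s)\mathrel\sigma(us^+,s)$; (S2) for all $s,t\in T$: $(s^+,s)\mathrel\sigma(t^+,t)\Rightarrow s=t$; (S3) for all $u,v\in V$, $s,t\in T$: $(u,s)\mathrel\sigma(v,t)\Rightarrow us^+=vt^+$; (S4) $\sigma_1=\Delta_T$; (S5) for all $u\in V$, $\sigma_u$ is a right congruence on $T$; (S6) for all $u,w\in V$: $\sigma_u\subseteq\sigma_{wu}$; (S7) for all $u\in V$, $x\in T$: $\{(xs,xt):(s,t)\in\sigma_u\}\subseteq\sigma_{{}^xu}$; (S8) for all $u,w\in V$ and $(s,t)\in\sigma_u$: $u\cdot{}^sw=u\cdot{}^tw$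 and $(s,t)\in\sigma_{u\cdot{}^sw}$. In the converse statement these definitions are applied with $V=U$, $T=S$, and $U^1=U\cup\{1\}$ with $1$ the identity of the over-monoid $M$ (with $\sigma_1=\Delta_S$ by definition if $1\notin U$). *)

(* Defs.v *)
From HB Require Import structures.
From mathcomp Require Import all_boot boolp.

Set Implicit Arguments.
Unset Strict Implicit.
Unset Printing Implicit Defensive.

Local Open Scope group_scope.
Local Open Scope quotient_scope.

Definition isomorphic (G H : semigroupType) : Prop :=
  exists f : {multiplicative G -> H}, bijective f.

(* A monoid of the form V u {1} for a semigroup V.  The cases that matter are
   the monoid completion V^1 and, for V a subsemigroup of a monoid M, the
   submonoid V u {1_M}; when V has an identity of its own, the latter need not
   be V. *)
Record unitization (V : semigroupType) := Unitization {
  uz_carrier :> monoidType;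
  uz_emb : {multiplicative V -> uz_carrier};
  uz_inj : injective uz_emb;
  uz_cover : forall w : uz_carrier, w = 1 \/ exists v, w = uz_emb v
}.

(* * The monoid completion *)

Definition is_identity (V : semigroupType) (e : V) : Prop :=
  left_id e *%g /\ right_id e *%g.

Definition has_identity (V : semigroupType) : Prop :=
  exists e : V, is_identity e.

Definition self_monoid (V : semigroupType) of has_identity V : Type := V.

Section SelfMonoid.
Variables (V : semigroupType) (h : has_identity V).
HB.instance Definition _ := Semigroup.copy (self_monoid h) V.

Let e : self_monoid h := sval (cid h).

Let mul1e : left_id e (@mul (self_monoid h)).
Proof. exact: (svalP (cid h)).1. Qed.

Let mule1 : right_id e (@mul (self_monoid h)).
Proof. exact: (svalP (cid h)).2. Qed.

HB.instance Definition _ :=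
  Semigroup_isMonoid.Build (self_monoid h) mul1e mule1.

Definition self_emb (v : V) : self_monoid h := v.

Let self_embM : {morph self_emb : x y / x * y}.
Proof. by []. Qed.

HB.instance Definition _ :=
  isMultiplicative.Build V (self_monoid h) self_emb self_embM.

Let self_emb_inj : injective self_emb.
Proof. by []. Qed.

Let self_cover (w : self_monoid h) : w = 1 \/ exists v, w = self_emb v.
Proof. by right; exists w. Qed.

Definition self_unitization : unitization V :=
  Unitization self_emb_inj self_cover.
End SelfMonoid.

Definition adjoin_one (V : semigroupType) : Type := option V.

Section AdjoinOne.
Variable V : semigroupType.
HB.instance Definition _ := Choice.copy (adjoin_one V) (option V).

Definition adjoin_mul (x y : adjoin_one V) : adjoin_one V :=
  match x, y with
  | None, _ => y
  | _, None => x
  | Some v, Some w => Some (v * w)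
  end.

Let adjoin_mulA : associative adjoin_mul.
Proof. by move=> [x|] [y|] [z|] //=; rewrite mulgA. Qed.

Let adjoin_mul1 : left_id None adjoin_mul.
Proof. by []. Qed.

Let adjoin_1mul : right_id None adjoin_mul.
Proof. by case. Qed.

HB.instance Definition _ :=
  isMonoid.Build (adjoin_one V) adjoin_mulA adjoin_mul1 adjoin_1mul.

Definition adjoin_emb (v : V) : adjoin_one V := Some v.

Let adjoin_embM : {morph adjoin_emb : x y / x * y}.
Proof. by []. Qed.

HB.instance Definition _ :=
  isMultiplicative.Build V (adjoin_one V) adjoin_emb adjoin_embM.

Let adjoin_emb_inj : injective adjoin_emb.
Proof. by move=> x y []. Qed.

Let adjoin_cover (w : adjoin_one V) : w = 1 \/ exists v, w = adjoin_emb v.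
Proof. by case: w => [v|]; [right; exists v | left]. Qed.

Definition adjoin_unitization : unitization V :=
  Unitization adjoin_emb_inj adjoin_cover.
End AdjoinOne.

Definition completion (V : semigroupType) : unitization V :=
  match pselect (has_identity V) with
  | left h => self_unitization h
  | right _ => adjoin_unitization V
  end.

(* * Subsemigroups of a monoid *)

Definition subsemigroup (M : monoidType) (U : mulgClosed M) : Type :=
  {x : M | x \in U}.

Section Subsemigroup.
Variables (M : monoidType) (U : mulgClosed M).
HB.instance Definition _ := SubChoice.on (subsemigroup U).
HB.instance Definition _ :=
  SubChoice_isSubSemigroup.Build M [in U] (subsemigroup U) (@gpredM _ U).

Definition with1 : {pred M} := [predU1 1 & U].

Let with1_closed : monoid_closed with1.
Proof.
split=> [|x y]; rewrite ?inE ?eqxx //.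
case/orP=> [/eqP->|xU]; rewrite ?mul1g //.
by case/orP=> [/eqP->|yU]; rewrite ?mulg1 ?xU ?orbT // gpredM ?orbT.
Qed.

Definition submonoid1 : Type := {x : M | x \in with1}.
HB.instance Definition _ := SubChoice.on submonoid1.
HB.instance Definition _ :=
  SubChoice_isSubMonoid.Build M [in with1] submonoid1 with1_closed.

Let sub_with1 (u : subsemigroup U) : val u \in with1.
Proof. by rewrite inE (valP u) orbT. Qed.

Definition sub_emb (u : subsemigroup U) : submonoid1 := Sub (val u) (sub_with1 u).

Let sub_embM : {morph sub_emb : x y / x * y}.
Proof. by move=> x y; apply: val_inj. Qed.

HB.instance Definition _ :=
  isMultiplicative.Build (subsemigroup U) submonoid1 sub_emb sub_embM.

Let sub_emb_inj : injective sub_emb.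
Proof. by move=> x y [] /val_inj. Qed.

Let sub_cover (w : submonoid1) : w = 1 \/ exists u, w = sub_emb u.
Proof.
have /orP[/eqP w1|wU] := valP w; [left|right]; first exact: val_inj.
by exists (Sub (val w) wU); apply: val_inj.
Qed.

Definition sub_unitization : unitization (subsemigroup U) :=
  Unitization sub_emb_inj sub_cover.
End Subsemigroup.

(* * Actions and semidirect products *)

(* A left action by semigroup morphisms; an identity of T, if there is one, need
   not act identically. *)
Record action (T : semigroupType) (X : semigroupType) := Action {
  act :> T -> X -> X;
  actA : forall s t x, act s (act t x) = act (s * t) x;
  actM : forall s x y, act s (x * y) = act s x * act s y
}.

Definition by_monoid_morphisms (T : semigroupType) (X : monoidType)
    (a : action T X) : Prop :=
  forall s, a s 1 = 1.

Section SemidirectProduct.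
Variables (V : semigroupType) (V1 : unitization V).
Local Notation i := (uz_emb V1).

Lemma uz_mulr_ex (u : V) (w : V1) : exists v, i v = i u * w.
Proof.
by have [->|[v ->]] := uz_cover w; [exists u; rewrite mulg1 | exists (u * v); rewrite gmulfM].
Qed.

(* the product of u in V and w in V^1, as an element of V *)
Definition uz_mulr (u : V) (w : V1) : V := sval (cid (uz_mulr_ex u w)).

Lemma uz_mulrE u w : i (uz_mulr u w) = i u * w.
Proof. exact: svalP (cid (uz_mulr_ex u w)). Qed.

Variables (T : semigroupType).

Definition semidirect of action T V1 : Type := (V * T)%type.

Variable a : action T V1.
HB.instance Definition _ := Choice.copy (semidirect a) (V * T)%type.

Definition semidirect_mul (p q : semidirect a) : semidirect a :=
  (uz_mulr p.1 (a p.2 (i q.1)), p.2 * q.2).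

Let semidirect_mulA : associative semidirect_mul.
Proof.
move=> [u r] [v s] [w t]; rewrite /semidirect_mul /= mulgA; congr pair.
by apply: (@uz_inj _ V1); rewrite !uz_mulrE actM actA mulgA.
Qed.

HB.instance Definition _ := isSemigroup.Build (semidirect a) semidirect_mulA.
End SemidirectProduct.

(* * Congruences and quotients *)

Record congruence (G : semigroupType) := Congruence {
  cong_rel :> equiv_rel G;
  congM : forall x x' y y', cong_rel x x' -> cong_rel y y' ->
    cong_rel (x * y) (x' * y')
}.

Definition quotient (G : semigroupType) (c : congruence G) : Type :=
  {eq_quot c}.

Section Quotient.
Variables (G : semigroupType) (c : congruence G).
HB.instance Definition _ := Choice.on (quotient c).
HB.instance Definition _ := EqQuotient.on (quotient c).

Definition quotient_mul (x y : quotient c) : quotient c :=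
  \pi_(quotient c) (repr x * repr y).

Lemma quotient_pi_mul (x y : G) :
  quotient_mul (\pi_(quotient c) x) (\pi_(quotient c) y) = \pi_(quotient c) (x * y).
Proof.
by apply/eqmodP/congM; apply/eqmodP; rewrite reprK.
Qed.

Let quotient_mulA : associative quotient_mul.
Proof.
elim/quotW=> x; elim/quotW=> y; elim/quotW=> z.
rewrite (quotient_pi_mul y z) (quotient_pi_mul x (y * z)).
by rewrite (quotient_pi_mul x y) (quotient_pi_mul (x * y) z) mulgA.
Qed.

HB.instance Definition _ := isSemigroup.Build (quotient c) quotient_mulA.
End Quotient.

Definition right_congruence (T : semigroupType) (R : T -> T -> Prop) : Prop :=
  [/\ forall s, R s s,
      forall s t, R s t -> R t s,
      forall r s t, R r s -> R s t -> R r t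
    & forall s t x, R s t -> R (s * x) (t * x)].

(* * Special congruences *)

Section Special.
Variables (V T : semigroupType) (V1 : unitization V) (a : action T V1).
Variable sigma : congruence (semidirect a).
Local Notation i := (uz_emb V1).

(* The relation sigma_w for w in V^1: the second disjunct is the convention
   that sigma_1 is the diagonal when 1 is not in V. *)
Definition slice (w : V1) (s t : T) : Prop :=
  (exists2 u : V, w = i u & sigma (u, s) (u, t)) \/
  [/\ ~ (exists e : V, i e = 1), w = 1 & s = t].

Record special : Prop := Special {
  spec1 : forall (u : V) (s : T), sigma (u, s) (uz_mulr u (a s 1), s);
  (* s^+ lies in V^1 and may fall outside V, in which case nothing is asked *)
  spec2 : forall (s t : T) (u v : V), i u = a s 1 -> i v = a t 1 ->
    sigma (u, s) (v, t) -> s = t;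
  spec3 : forall (u v : V) (s t : T), sigma (u, s) (v, t) ->
    i u * a s 1 = i v * a t 1;
  spec4 : forall s t : T, slice 1 s t <-> s = t;
  spec5 : forall u : V, right_congruence (slice (i u));
  spec6 : forall (u w : V) (s t : T), slice (i u) s t -> slice (i (w * u)) s t;
  spec7 : forall (u : V) (x s t : T), slice (i u) s t ->
    slice (a x (i u)) (x * s) (x * t);
  spec8 : forall (u w : V) (s t : T), slice (i u) s t ->
    i u * a s (i w) = i u * a t (i w) /\ slice (i u * a s (i w)) s t
}.
End Special.

(* * Action pairs *)

Record action_pair (M : monoidType) := ActionPair {
  apU : mulgClosed M;
  apS : mulgClosed M;
  ap_act : action (subsemigroup apS) (sub_unitization apU);
  ap1 : forall (s : subsemigroup apS) (u : submonoid1 apU),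
    val s * val u = val (ap_act s u) * val s;
  ap2 : forall (u v : submonoid1 apU) (s t : subsemigroup apS),
    val u * val s = val v * val t -> u * ap_act s 1 = v * ap_act t 1
}.

Definition strong (M : monoidType) (P : action_pair M) : Prop :=
  (forall (s : subsemigroup (apS P)) (u : submonoid1 (apU P)),
     exists v : submonoid1 (apU P), val s * val u = val v * val s) /\
  (forall (u v : submonoid1 (apU P)) (s t : subsemigroup (apS P)),
     val u * val s = val v * val t -> u = v).

Section ProductSubsemigroup.
Variables (M : monoidType) (P : action_pair M).

Definition apUS : {pred M} :=
  [pred x | `[< exists (u : subsemigroup (apU P)) (s : subsemigroup (apS P)),
                  x = val u * val s >]].

Let apUS_closed : mulg_closed apUS.
Proof.
move=> _ _ /asboolP[u [s ->]] /asboolP[v [t ->]]; apply/asboolP.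
pose w := ap_act P s (sub_emb v).
exists (uz_mulr (V1 := sub_unitization (apU P)) u w), (s * t).
have /(congr1 val)/= -> := uz_mulrE (V1 := sub_unitization (apU P)) u w.
have /= su := ap1 s (sub_emb v : submonoid1 (apU P)).
by rewrite -!mulgA [sval s * _]mulgA su -mulgA.
Qed.

HB.instance Definition _ := isMulClosed.Build M apUS apUS_closed.
End ProductSubsemigroup.

(* Main.v *)
Require Import Defs.
From HB Require Import structures.
From mathcomp Require Import all_boot boolp.

(** For an action pair [(U, S)], the map [(u, s) |-> us] is a morphism from
    [U >< S] onto [US], because [s] slides past [v] by [sv = (s.v)s].  Its kernel
    is the required congruence: its slice at [w] relates [s] and [t] when
    [ws = wt], so each axiom of a special congruence is a short calculation in
    [M] with sliding and (A2) (lemma [special_of_action_pair]).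

    In the other direction, let [s^+] stand for [s.1].  The axioms (S1) and (S3)
    show that [sigma] is determined by its slices: [(u, s)] and [(v, t)] are
    related exactly when [us^+ = vt^+ =: w] and the slice at [w] relates [s] and
    [t] (lemma [special_slices]).  This description makes sense for [u], [v] in
    all of [V^1], and also after an identity acting trivially is adjoined to [T],
    as the remaining axioms extend to the larger ranges.  It then defines a
    congruence on the larger semidirect product [V^1 >< (T + 1)], and the quotient
    [M] is a monoid although the semidirect product is only a semigroup when some
    [s^+] is not 1: right multiplication by [(1, 1)] sends [(u, s)] to
    [(us^+, s)], which lies in the same class (lemma [slice_family_monoid]).
    In [M] the classes of [(v, 1)] form a copy of [V^1], those of [(1, s)] a copy
    of [T] (injectivity of the latter is what (S2) and (S4) provide), and
    [(u, 1)(1, s) = (u, s)].  So the product of the copies of [V] and [T] is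
    [(V >< T) / sigma], (A1) and (A2) are read off from the multiplication and
    the congruence of [M], and (A2) is (SA2) as soon as all [s^+] are 1. *)

Set Implicit Arguments.
Unset Strict Implicit.
Unset Printing Implicit Defensive.

Local Open Scope group_scope.
Local Open Scope quotient_scope.

(** * Isomorphisms onto subsemigroups, and kernels *)

Lemma subsemigroup_isomorphic (M : monoidType) (U : mulgClosed M)
    (G : semigroupType) (f : G -> M) :
  {morph f : x y / x * y} -> injective f ->
  (forall x, x \in U <-> exists g, x = f g) -> isomorphic (subsemigroup U) G.
Proof.
move=> fM f_inj Uf.
have ex (x : subsemigroup U) : exists g, val x = f g by apply/Uf/(valP x).
pose h x := sval (cid (ex x)).
have hE x : f (h x) = val x by rewrite -(svalP (cid (ex x))).
have hM : {morph h : x y / x * y} by move=> x y; apply: f_inj; rewrite fM !hE.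
have fU g : f g \in U by apply/Uf; exists g.
pose k g : subsemigroup U := Sub (f g) (fU g).
pose h' : {multiplicative subsemigroup U -> G} :=
  HB.pack h (isMultiplicative.Build _ _ h hM).
exists h'; exists k => [x|g] /=.
  by apply: val_inj; rewrite /= hE.
by apply: f_inj; rewrite hE.
Qed.

Lemma quotient_isomorphic (M : monoidType) (U : mulgClosed M)
    (G : semigroupType) (c : congruence G) (f : G -> M) :
  {morph f : x y / x * y} -> (forall x y, c x y <-> f x = f y) ->
  (forall x, x \in U <-> exists g, x = f g) ->
  isomorphic (subsemigroup U) (quotient c).
Proof.
move=> fM cf Uf.
have f_repr g : f (repr (\pi_(quotient c) g)) = f g.
  by apply/cf/eqmodP; rewrite reprK.
apply: (@subsemigroup_isomorphic _ _ _ (fun q : quotient c => f (repr q))).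
- by move=> x y; rewrite -fM; apply: f_repr.
- by move=> x y /cf /eqmodP; rewrite !reprK.
move=> x; rewrite Uf; split=> [[g ->]|[q ->]]; last by exists (repr q).
by exists (\pi_(quotient c) g); rewrite f_repr.
Qed.

(** Congruences are boolean relations; the ones below are defined by propositions. *)
Lemma congruence_of_rel (G : semigroupType) (R : G -> G -> Prop) :
  (forall x, R x x) -> (forall x y, R x y -> R y x) ->
  (forall x y z, R x y -> R y z -> R x z) ->
  (forall x x' y y', R x x' -> R y y' -> R (x * y) (x' * y')) ->
  exists c : congruence G, forall x y, c x y <-> R x y.
Proof.
move=> Rr Rs Rt RM; pose r x y := `[< R x y >].
have rr : reflexive r by move=> x; apply/asboolP.
have rs : symmetric r by move=> x y; apply/asboolP/asboolP; apply: Rs.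
have rt : transitive r.
  by move=> y x z /asboolP xy /asboolP yz; apply/asboolP; apply: Rt yz.
have rM x x' y y' : r x x' -> r y y' -> r (x * y) (x' * y').
  by move=> /asboolP xx /asboolP yy; apply/asboolP; apply: RM.
exists (@Congruence G (EquivRel r rr rs rt) rM) => x y.
by split=> /asboolP.
Qed.

(** * The monoid of a family of right congruences *)

(** Axioms (S5)-(S8) for slices indexed by a whole monoid, which plays the role of
    [V^1].  They are what makes the slices fit together into a congruence. *)
Record slice_family (N : monoidType) (K : semigroupType) (a : action K N)
    (L : N -> K -> K -> Prop) : Prop := SliceFamily {
  sf_right : forall w, right_congruence (L w);
  sf_mull : forall u w s t, L u s t -> L (w * u) s t;
  sf_act : forall u x s t, L u s t -> L (a x u) (x * s) (x * t);
  sf_agree : forall u w s t, L u s t -> u * a s w = u * a t w;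
  sf_shift : forall u w s t, L u s t -> L (u * a s w) s t
}.

(** A monoid acted upon takes part in a semidirect product through this
    unitization, which adds no new identity. *)
Definition id_unitization (N : monoidType) : unitization N :=
  @Unitization N N idfun (@inj_id N) (fun w => or_intror (ex_intro _ w erefl)).

(** [M] is the semidirect product of [N] and [K] modulo the equivalence in the
    last clause, and [p u s] is the class of [(u, s)].  That equivalence is
    compatible with products: if [w = us^+] and [x = vt^+], then the product of
    [(u, s)] and [(v, t)] has [w * a s x] in place of [us^+].  The slice at
    [w * a s x] contains the slice at [w] by [sf_shift] and the translate by [s] of
    the slice at [x] by [sf_act] and [sf_mull]. *)
Lemma slice_family_monoid (N K : monoidType) (a : action K N)
    (L : N -> K -> K -> Prop) :
  (forall w, a 1 w = w) -> slice_family a L ->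
  exists (M : monoidType) (p : N -> K -> M),
    [/\ p 1 1 = 1,
        forall u v s t, p u s * p v t = p (u * a s v) (s * t)
      & forall u v s t, p u s = p v t <->
          u * a s 1 = v * a t 1 /\ L (u * a s 1) s t].
Proof.
move=> a1 LF.
have [Lr Ls Lt LM] : [/\ forall w s, L w s s,
    forall w s t, L w s t -> L w t s,
    forall w r s t, L w r s -> L w s t -> L w r t
  & forall w s t x, L w s t -> L w (s * x) (t * x)].
  by split=> w; have [? ? ? ?] := sf_right LF w.
pose G : semigroupType := @semidirect N (id_unitization N) K a.
have GM (p q : G) : p * q = (p.1 * a p.2 q.1, p.2 * q.2) :> G.
  by congr pair; apply: (uz_mulrE (V1 := id_unitization N)).
pose n (p : G) : N := p.1 * a p.2 1.
pose R (p q : G) := n p = n q /\ L (n p) p.2 q.2.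
have nM p q : n (p * q) = p.1 * a p.2 (n q).
  by rewrite GM /n /= -actA -mulgA -actM.
have nE p w : p.1 * a p.2 w = n p * a p.2 w.
  by rewrite /n -mulgA -actM mul1g.
have n1 : n (1, 1) = 1 by rewrite /n /= a1 mulg1.
have [|||p p' q q'|c cR] := @congruence_of_rel G R.
- by move=> p; split.
- by move=> p q [pq ?]; split; rewrite -?pq //; apply: Ls.
- move=> p q r [pq Lpq] [qr Lqr]; split; rewrite ?pq //.
  by apply: Lt Lqr; rewrite -pq.
- move=> [pp Lp] [qq Lq]; rewrite /R !nM !nE -pp -qq; split.
    exact: sf_agree LF _ _ _ _ Lp.
  (* change the right factor first, then the left one *)
  rewrite !GM /=; apply: (Lt _ _ (p.2 * q'.2)).
    by apply: (sf_mull LF); apply: (sf_act LF).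
  by apply: LM; apply: (sf_shift LF).
have e1 : left_id (\pi_(quotient c) ((1, 1) : G)) *%g.
  elim/quotW=> p; rewrite [LHS]quotient_pi_mul; apply/eqmodP/cR.
  by rewrite GM /= mul1g a1 mul1g -surjective_pairing; split.
have e2 : right_id (\pi_(quotient c) ((1, 1) : G)) *%g.
  elim/quotW=> p; rewrite [LHS]quotient_pi_mul; apply/eqmodP/cR.
  by rewrite /R nM n1 GM /= mulg1; split.
pose M : monoidType :=
  HB.pack (quotient c) (Semigroup_isMonoid.Build (quotient c) e1 e2).
exists M, (fun u s => \pi_(quotient c) ((u, s) : G)); split=> //.
  by move=> u v s t; rewrite [LHS]quotient_pi_mul GM.
move=> u v s t; apply: iff_trans (cR (u, s) (v, t)).
by split=> /eqmodP.
Qed.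

(** * Adjoining an identity to the acting semigroup *)

(** The copy of [V^1] inside [M] consists of the classes of the pairs [(v, 1)],
    which requires an element 1 of the acting semigroup that fixes all of [N].  An
    identity that [T] may already have need not do so; hence one is adjoined in
    all cases. *)

Section AdjoinIdentity.
Variables (N : monoidType) (T : semigroupType) (a : action T N).

Definition adjoin_act (s : adjoin_one T) (w : N) : N :=
  if s is Some t then a t w else w.

Lemma adjoin_actA s t w : adjoin_act s (adjoin_act t w) = adjoin_act (s * t) w.
Proof. by case: s t => [s|] [t|] //=; apply: actA. Qed.

Lemma adjoin_actM s v w : adjoin_act s (v * w) = adjoin_act s v * adjoin_act s w.
Proof. by case: s => [s|] //=; apply: actM. Qed.

Definition adjoin_action : action (adjoin_one T) N := Action adjoin_actA adjoin_actM.

(** The new identity is related to itself alone, so that [(v, 1)] and [(w, 1)]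
    become equal in [M] only for [v = w]. *)
Definition adjoin_slice (L : N -> T -> T -> Prop) (w : N) (s t : adjoin_one T) :=
  match s, t with
  | Some s, Some t => L w s t
  | None, None => True
  | _, _ => False
  end.

Lemma adjoin_slice_family L :
  slice_family a L -> slice_family adjoin_action (adjoin_slice L).
Proof.
move=> LF; split.
- move=> w; have [Lr Ls Lt LM] := sf_right LF w; split.
  + by case=> /=.
  + by move=> [s|] [t|] //=; apply: Ls.
  + by move=> [r|] [s|] [t|] //=; apply: Lt.
  + by move=> [s|] [t|] [x|] //=; apply: LM.
- by move=> u w [s|] [t|] //=; apply: (sf_mull LF).
- move=> u [x|] [s|] [t|] //= st; first exact: sf_act LF _ _ _ _ st.
  by have [] := sf_right LF (a x u).
- by move=> u w [s|] [t|] //=; apply: (sf_agree LF).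
- by move=> u w [s|] [t|] //=; apply: (sf_shift LF).
Qed.
End AdjoinIdentity.

(** * The slices of a special congruence *)

Section SpecialSlices.
Variables (V T : semigroupType) (V1 : unitization V) (a : action T V1).
Variables (sigma : congruence (semidirect a)) (sp : special sigma).
Local Notation i := (uz_emb V1).
Local Notation L := (slice sigma).

(** The convention for [sigma_1] when 1 is not in [V] never concerns an element
    of [V]. *)
Lemma slice_emb u s t : L (i u) s t <-> sigma (u, s) (u, t).
Proof.
split=> [[[u' /uz_inj <-] //|[n1 u1 _]]|st]; last by left; exists u.
by case: n1; exists u.
Qed.

(** By (S1), each pair can be replaced by [(us^+, s)] within its class, and (S3)
    makes the first components of these normalized pairs equal. *)
Lemma special_slices u v s t :
  sigma (u, s) (v, t) <->
  i u * a s 1 = i v * a t 1 /\ L (i u * a s 1) s t.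
Proof.
have [us vt] := (spec1 sp u s, spec1 sp v t).
split=> [st|[]]; rewrite -!uz_mulrE.
  have /uz_inj pq : i (uz_mulr u (a s 1)) = i (uz_mulr v (a t 1)).
    by rewrite !uz_mulrE; apply: spec3 st.
  split; first by rewrite pq.
  apply/slice_emb; rewrite {2}pq; apply: equiv_trans vt.
  by apply: equiv_trans st; rewrite equiv_sym.
move=> /uz_inj pq /slice_emb st; apply: equiv_trans us _.
by apply: equiv_trans st _; rewrite pq equiv_sym.
Qed.

(** (S5)-(S8) speak of elements of [V].  They pass to [V^1] since by (S4) the slice
    at 1 is the diagonal; the new case of (S8), with the element acted on equal
    to 1, is (S3) together with (S1). *)
Lemma special_slice_family : slice_family a L.
Proof.
have L1 s t : L 1 s t -> s = t by move/(spec4 sp).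
have Lr w : right_congruence (L w).
  have [->|[u ->]] := uz_cover w; last exact: spec5.
  by split=> [s|s t /L1->|r s t /L1-> /L1->|s t x /L1->]; apply/(spec4 sp).
have Lrefl w s : L w s s by have [? _ _ _] := Lr w.
split=> //.
- move=> u w s t; have [->|[v ->]] := uz_cover u; first by move/L1=> ->.
  have [->|[x ->]] := uz_cover w; first by rewrite mul1g.
  by rewrite -gmulfM; apply: spec6.
- move=> u x s t; have [->|[v ->]] := uz_cover u; first by move/L1=> ->.
  exact: spec7.
- move=> u w s t; have [->|[v ->]] := uz_cover u; first by move/L1=> ->.
  have [->|[x ->]] := uz_cover w; last by case/(spec8 sp x).
  by move/slice_emb/(spec3 sp).
- move=> u w s t; have [->|[v ->]] := uz_cover u; first by move/L1=> ->.
  have [->|[x ->]] := uz_cover w; last by case/(spec8 sp x).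
  by case/slice_emb/special_slices.
Qed.

(** The reason why [T] embeds in [M] by the classes of the pairs [(1, s)]: this is
    (S2) when [s^+] lies in [V], and (S4) when [s^+] is 1. *)
Lemma slice_plus_inj s t : a s 1 = a t 1 -> L (a s 1) s t -> s = t.
Proof.
have [->|[u su]] := uz_cover (a s 1); first by move=> _ /(spec4 sp).
rewrite su => ut /slice_emb; exact: spec2 ut.
Qed.
End SpecialSlices.

(** * Action pairs from embeddings *)

(** Action pairs are made of subsets of [M].  This transports the action from
    [V^1] and [T] to their copies in [M], so that only equations between embedded
    elements remain to be checked. *)
Lemma action_pair_of_embeddings (V T : semigroupType) (V1 : unitization V)
    (a : action T V1) (M : monoidType) (j : V1 -> M) (k : T -> M) :
  j 1 = 1 -> {morph j : v w / v * w} -> injective j ->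
  {morph k : s t / s * t} -> injective k ->
  (forall s v, k s * j v = j (a s v) * k s) ->
  (forall v w s t, j v * k s = j w * k t -> v * a s 1 = w * a t 1) ->
  exists P : action_pair M,
    [/\ forall x, x \in apU P <-> exists v, x = j (uz_emb V1 v),
        forall x, x \in apS P <-> exists s, x = k s
      & by_monoid_morphisms a -> strong P].
Proof.
move=> j1 jM j_inj kM k_inj jk jk_plus.
pose pU : {pred M} := [pred x | `[< exists v, x = j (uz_emb V1 v) >]].
pose pS : {pred M} := [pred x | `[< exists s, x = k s >]].
have UM : mulg_closed pU.
  move=> _ _ /asboolP[v ->] /asboolP[w ->]; apply/asboolP.
  by exists (v * w); rewrite gmulfM jM.
have SM : mulg_closed pS.
  move=> _ _ /asboolP[s ->] /asboolP[t ->]; apply/asboolP.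
  by exists (s * t); rewrite kM.
pose U : mulgClosed M := HB.pack pU (isMulClosed.Build M pU UM).
pose S : mulgClosed M := HB.pack pS (isMulClosed.Build M pS SM).
have jU1 w : j w \in with1 U.
  rewrite inE; have [->|[v ->]] := uz_cover w; first by rewrite j1 eqxx.
  by apply/orP; right; apply/asboolP; exists v.
have exj (u : submonoid1 U) : exists w, val u = j w.
  have /orP[/eqP ->|/asboolP[v ->]] := valP u; first by exists 1.
  by exists (uz_emb V1 v).
have exk (s : subsemigroup S) : exists t, val s = k t by have /asboolP := valP s.
pose j' u := sval (cid (exj u)); pose k' s := sval (cid (exk s)).
have j'E u : j (j' u) = val u by rewrite -(svalP (cid (exj u))).
have k'E s : k (k' s) = val s by rewrite -(svalP (cid (exk s))).
pose J w : submonoid1 U := Sub (j w) (jU1 w).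
have JK : cancel J j' by move=> w; apply: j_inj; rewrite j'E.
have JM : {morph J : v w / v * w} by move=> v w; apply: val_inj; apply: jM.
have j'M : {morph j' : u v / u * v} by move=> u v; apply: j_inj; rewrite jM !j'E.
have k'M : {morph k' : s t / s * t} by move=> s t; apply: k_inj; rewrite kM !k'E.
have j'1 : j' 1 = 1 by apply: j_inj; rewrite j'E j1.
pose b s u := J (a (k' s) (j' u)).
have bA s t u : b s (b t u) = b (s * t) u by rewrite /b JK actA k'M.
have bM s u v : b s (u * v) = b s u * b s v by rewrite /b j'M actM JM.
pose B : action (subsemigroup S) (sub_unitization U) := Action bA bM.
have B1 (s : subsemigroup S) (u : submonoid1 U) :
    val s * val u = val (B s u) * val s.
  by rewrite -k'E -j'E /= jk.
have plus (u v : submonoid1 U) (s t : subsemigroup S) :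
    val u * val s = val v * val t -> j' u * a (k' s) 1 = j' v * a (k' t) 1.
  by rewrite -!k'E -!j'E; apply: jk_plus.
have B2 (u v : submonoid1 U) (s t : subsemigroup S) :
    val u * val s = val v * val t -> u * B s 1 = v * B t 1.
  move/plus=> /(congr1 j); rewrite !jM !j'E => uv; apply: val_inj.
  by rewrite /= /b !j'1.
exists (ActionPair B1 B2); split=> /= [x|x|a1].
- by split=> [/asboolP|?]; last apply/asboolP.
- by split=> [/asboolP|?]; last apply/asboolP.
split=> [s u|u v s t /plus]; first by exists (B s u); apply: B1.
by rewrite !a1 !mulg1 => uv; apply: val_inj; rewrite -!j'E uv.
Qed.

(** * From special congruences to action pairs, and back *)

Lemma action_pair_of_special (V T : semigroupType) (V1 : unitization V)
    (a : action T V1) (sigma : congruence (semidirect a)) :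
  special sigma ->
  exists (M : monoidType) (P : action_pair M),
    [/\ isomorphic (subsemigroup (apU P)) V,
        isomorphic (subsemigroup (apS P)) T,
        isomorphic (subsemigroup (apUS P)) (quotient sigma)
      & by_monoid_morphisms a -> strong P].
Proof.
move=> sp.
have [//|M [p [p1 pM pE]]] := @slice_family_monoid V1 (adjoin_one T)
  (adjoin_action a) _ _ (adjoin_slice_family (special_slice_family sp)).
pose j (w : V1) := p w 1; pose k (s : T) := p 1 (Some s).
have jk u s : j u * k s = p u (Some s) by rewrite pM /= mulg1.
have jM : {morph j : v w / v * w} by move=> v w; rewrite /j pM mulg1.
have j_inj : injective j by move=> v w /pE[]; rewrite /= !mulg1.
have kM : {morph k : s t / s * t}.
  move=> s t; rewrite /k pM; apply/pE; rewrite /= !mul1g.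
  split; first by rewrite -(actA a) -(actM a) mul1g.
  by have [] := sf_right (special_slice_family sp) (a (s * t) 1).
have k_inj : injective k.
  by move=> s t /pE[]; rewrite /= !mul1g; apply: slice_plus_inj.
have kj s v : k s * j v = j (a s v) * k s by rewrite jk pM mul1g.
have jk_plus v w s t : j v * k s = j w * k t -> v * a s 1 = w * a t 1.
  by rewrite !jk => /pE[].
have [P [UE SE P_strong]] :=
  action_pair_of_embeddings p1 jM j_inj kM k_inj kj jk_plus.
exists M, P; split=> //.
- apply: (subsemigroup_isomorphic _ _ UE); last by move=> v w /j_inj /uz_inj.
  by move=> v w; rewrite gmulfM jM.
- exact: subsemigroup_isomorphic SE.
pose f (q : semidirect a) := j (uz_emb V1 q.1) * k q.2.
apply: (@quotient_isomorphic _ _ _ _ f).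
- move=> [u s] [v t]; rewrite /f /= uz_mulrE jM kM -!mulgA; congr (_ * _).
  by rewrite !mulgA kj.
- by move=> [u s] [v t]; rewrite special_slices // /f /= !jk pE.
move=> x; split=> [/asboolP[u [s ->]]|[[u s] ->]].
  have [v ->] := (UE _).1 (valP u); have [t ->] := (SE _).1 (valP s).
  by exists (v, t).
have uU : j (uz_emb V1 u) \in apU P by apply/UE; exists u.
have sS : k s \in apS P by apply/SE; exists s.
by apply/asboolP; exists (Sub (j (uz_emb V1 u)) uU : subsemigroup (apU P)),
  (Sub (k s) sS : subsemigroup (apS P)).
Qed.

Lemma special_of_action_pair (M : monoidType) (P : action_pair M) :
  exists theta : congruence (semidirect (ap_act P)),
    special theta /\ isomorphic (subsemigroup (apUS P)) (quotient theta).
Proof.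
pose V1 := sub_unitization (apU P); pose b := ap_act P.
have mulrE u (w : V1) : val (uz_mulr (V1 := V1) u w) = val u * val w.
  by have /(congr1 val) := uz_mulrE (V1 := V1) u w.
have slide s (w : submonoid1 (apU P)) : val s * val w = val (b s w) * val s.
  exact: ap1.
have plusK s : val (b s 1) * val s = val s by rewrite -slide mulg1.
pose f (q : semidirect b) : M := val q.1 * val q.2.
have fM : {morph f : x y / x * y}.
  move=> [u s] [v t]; rewrite /f /= mulrE -!mulgA; congr (_ * _).
  by rewrite !mulgA -slide.
have [||||theta thE] := @congruence_of_rel _ (fun x y => f x = f y) => //.
- by move=> x y z -> ->.
- by move=> x x' y y' xx yy; rewrite !fM xx yy.
exists theta; split; last first.
  apply: (quotient_isomorphic fM thE) => x.
  split=> [/asboolP[u [s ->]]|[[u s] ->]]; first by exists (u, s).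
  by apply/asboolP; exists u, s.
have sliceE (w : V1) s t :
    slice theta w s t <-> val w * val s = val w * val t.
  split=> [[[u -> /thE] //|[_ -> ->] //]|st].
  have [w1|[u wu]] := uz_cover (u := V1) w; last first.
    by left; exists u => //; apply/thE; rewrite wu in st.
  have [[e e1]|ne] := pselect (exists e, uz_emb V1 e = 1).
    left; exists e; first by rewrite w1 -e1.
    by apply/thE; rewrite /f /= -[sval e]/(val (uz_emb V1 e)) e1 -w1.
  by right; split=> //; move: st; rewrite w1 /= !mul1g => /val_inj.
split.
- by move=> u s; apply/thE; rewrite /f /= mulrE -mulgA plusK.
- move=> s t u v us vt /thE; rewrite /f /= -[sval u]/(val (uz_emb V1 u)).
  by rewrite -[sval v]/(val (uz_emb V1 v)) us vt !plusK => /val_inj.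
- by move=> u v s t /thE st; apply: (@ap2 _ P (uz_emb V1 u) (uz_emb V1 v)).
- by move=> s t; rewrite sliceE !mul1g; split=> [/val_inj|->].
- move=> u; split=> [s|s t|r s t|s t x]; rewrite !sliceE //=.
  + by move=> -> ->.
  + by move=> st; rewrite !mulgA st.
- by move=> u w s t; rewrite !sliceE /= -!mulgA => ->.
- by move=> u x s t; rewrite !sliceE /= !mulgA -!slide -!mulgA => ->.
move=> u w s t; rewrite !sliceE => st.
have uw (r : subsemigroup (apS P)) :
    val (uz_emb V1 u * b r (uz_emb V1 w)) * val r =
    val (uz_emb V1 u) * val r * val (uz_emb V1 w).
  by rewrite /= -mulgA -slide mulgA.
have uwst : uz_emb V1 u * b s (uz_emb V1 w) = uz_emb V1 u * b t (uz_emb V1 w).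
  (* (A2) compares the two sides only after multiplication by [s^+] and [t^+];
     these factors are already absorbed since [s.w = s.(w1) = (s.w)s^+] *)
  rewrite -[uz_emb V1 w]mulg1 !actM !mulgA.
  by apply: ap2; rewrite !uw st.
by split=> //; rewrite {2}uwst !uw st.
Qed.

Theorem theorem4p53 :
  (forall (V T : semigroupType) (a : action T (completion V))
      (sigma : congruence (semidirect a)),
    special sigma ->
    exists (M : monoidType) (P : action_pair M),
      [/\ isomorphic (subsemigroup (apU P)) V,
          isomorphic (subsemigroup (apS P)) T,
          isomorphic (subsemigroup (apUS P)) (quotient sigma)
        & by_monoid_morphisms a -> strong P]) /\
  (forall (M : monoidType) (P : action_pair M),
    exists theta : congruence (semidirect (ap_act P)),
      special theta /\ isomorphic (subsemigroup (apUS P)) (quotient theta)).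
Proof.
split; first by move=> V T a sigma; apply: action_pair_of_special.
exact: special_of_action_pair.
Qed.
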